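(* Every finite simple graph $G$ of radius two is universal antimagic orientable: for every set $L$ of $|E(G)|$ distinct positive real numbers, there exist an orientation $D$ of $G$ and a bijection $\tau:E(G)\to L$ such that the vertex sums $s_{(D,\tau)}(v)$, $v\in V(G)$, are pairwise distinct.
   Context: The eccentricity of a vertex $v$ in a connected graph $G$ is the maximum distance from $v$ to a vertex of $G$; the radius of $G$ is the minimum eccentricity over all vertices. For an orientation $D$ of $G$ and labeling $\tau:E(G)\to\mathbb{R}$, the vertex sum $s_{(D,\tau)}(v)$ is the sum of the labels of the edges directed into $v$ minus the sum of the labels of the edges directed out of $v$. $G$ is universal antimagic orientable if for every set $L$ of $|E(G)|$ positive real numbers there exist an orientation $D$ and a bijection $\tau:E(G)\to L$ making all vertex sums pairwise distinct. *)

(* Defs.v *)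
From HB Require Import structures.
From mathcomp Require Import all_boot all_order all_algebra.
From mathcomp Require Import finmap.
From mathcomp Require Import reals.

Set Implicit Arguments.
Unset Strict Implicit.
Unset Printing Implicit Defensive.

Import Order.TTheory GRing.Theory Num.Theory.
Local Open Scope ring_scope.

Record sgraph : Type := SGraph {
  vertex :> finType;
  adj : rel vertex;
  adj_sym : symmetric adj;
  adj_irrefl : irreflexive adj }.

Definition connected (G : sgraph) : Prop :=
  forall x y : G, connect (@adj G) x y.

Definition walk_of_length (G : sgraph) (x y : G) (n : nat) : bool :=
  [exists p : n.-tuple G, path (@adj G) x p && (last x p == y)].

(* Least length of a walk from x to y. A shortest walk has length < #|G|, so
   the search below is exhaustive; the value is #|G| iff y is not reachable
   from x. *)
Definition dist (G : sgraph) (x y : G) : nat :=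
  find (walk_of_length x y) (iota 0 #|G|).

Definition eccentricity (G : sgraph) (x : G) : nat :=
  \max_(y : G) dist x y.

(* Every eccentricity is at most #|G|, so the default value #|G| of the minimum
   is only relevant when G has no vertex. *)
Definition radius (G : sgraph) : nat :=
  \big[minn/#|G|]_(x : G) eccentricity x.

Definition edge_set (G : sgraph) : {set {set G}} :=
  [set [set p.1; p.2] | p : G * G & adj p.1 p.2].

Definition edge (G : sgraph) : finType := {a : {set G} | a \in edge_set G}.

(* The edge a is directed from arc_tail a to arc_head a. *)
Record orientation (G : sgraph) : Type := Orientation {
  arc_tail : edge G -> G;
  arc_head : edge G -> G;
  orientationP : forall a : edge G, val a = [set arc_tail a; arc_head a] }.

Definition vertex_sum (R : realType) (G : sgraph) (D : orientation G)
    (tau : edge G -> R) (v : G) : R :=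
  \sum_(a : edge G | arc_head D a == v) tau a
  - \sum_(a : edge G | arc_tail D a == v) tau a.

Definition universal_antimagic_orientable (R : realType) (G : sgraph) : Prop :=
  forall L : {fset R},
    #|` L|%fset = #|edge_set G| ->
    (forall x : R, x \in L -> 0 < x) ->
    exists (D : orientation G) (tau : edge G -> L),
      bijective tau /\ injective (vertex_sum D (fun a => val (tau a))).

(* Main.v *)
Require Import Defs.
From mathcomp Require Import all_boot all_order all_algebra.
From mathcomp Require Import finmap.
From mathcomp Require Import reals.
From mathcomp Require Import lra.

Set Implicit Arguments.
Unset Strict Implicit.
Unset Printing Implicit Defensive.

Import Order.TTheory GRing.Theory Num.Theory.
Local Open Scope ring_scope.

(* Let r have maximum degree among the vertices within distance two of all
   others, V1 = N(r), and V2 the vertices at distance two; fix for each v in V2 a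
   neighbour f v in V1. The largest labels go to the star at r, then the edges
   {f v, v}, then the other V1-V2 edges, and the smallest to the edges inside V1
   or inside V2. Edges go from V1 to V2 and from V1 to r; the inner edges can be
   oriented and labelled so that each vertex receives from them at most their
   largest label M in absolute value. Hence sums are positive on V2 and negative
   on V1, and assigning the tree (resp. star) labels in the order of the partial
   sums makes them distinct on V2 (resp. V1). Finally r gets the sum of the star
   labels, which exceeds the sum at every v in V2: if v misses a vertex of V1, it
   has fewer incoming edges, and M does not make up for the missing one; if v is
   adjacent to all of V1, it is itself within distance two of all vertices, so by
   maximality of deg r it has no neighbour in V2. *)

(** * Labelled arcs and their sums at vertices *)

(* A labelled arc (u, v, l) goes from u to v and carries the label l. *)
Definition arc_ends (R : Type) (V : finType) (x : V * V * R) : {set V} :=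
  [set x.1.1; x.1.2].

Definition net_sum (R : realFieldType) (V : finType)
    (T : seq (V * V * R)) (v : V) : R :=
  \sum_(x <- T) ((x.1.2 == v)%:R - (x.1.1 == v)%:R) * x.2.

(** Equality up to permutation makes each edge of [F] carry exactly one arc, so that lists for
    disjoint edge sets can be concatenated. *)
Definition orients (R : realFieldType) (V : finType)
    (T : seq (V * V * R)) (F : {set {set V}}) : bool :=
  perm_eq (map (@arc_ends R V) T) (enum F).

Lemma net_sum_cat (R : realFieldType) (V : finType)
    (T1 T2 : seq (V * V * R)) (v : V) :
  net_sum (T1 ++ T2) v = net_sum T1 v + net_sum T2 v.
Proof. exact: big_cat. Qed.

Lemma net_sum1 (R : realFieldType) (V : finType) (x : V * V * R) (v : V) :
  net_sum [:: x] v = ((x.1.2 == v)%:R - (x.1.1 == v)%:R) * x.2.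
Proof. exact: big_seq1. Qed.

Lemma orients_mem (R : realFieldType) (V : finType) (T : seq (V * V * R))
    (F : {set {set V}}) (x : V * V * R) :
  orients T F -> x \in T -> arc_ends x \in F.
Proof.
by move=> oT xT; rewrite -mem_enum -(perm_mem oT) map_f.
Qed.

Lemma net_sum_notin (R : realFieldType) (V : finType) (T : seq (V * V * R))
    (F : {set {set V}}) (v : V) :
  orients T F -> (forall e, e \in F -> v \notin e) -> net_sum T v = 0.
Proof.
move=> oT vF; apply: big1_seq => x /= xT.
have := vF _ (orients_mem oT xT).
by rewrite !inE negb_or ![v == _]eq_sym => /andP[/negPf-> /negPf->]; lra.
Qed.

Lemma orients_cat (R : realFieldType) (V : finType)
    (T1 T2 : seq (V * V * R)) (F1 F2 : {set {set V}}) :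
  orients T1 F1 -> orients T2 F2 -> [disjoint F1 & F2] ->
  orients (T1 ++ T2) (F1 :|: F2).
Proof.
move=> o1 o2 dF; rewrite /orients map_cat.
apply: (perm_trans (perm_cat o1 o2)); apply: uniq_perm.
- rewrite cat_uniq !enum_uniq andbT /=; apply/hasPn => e /=.
  by rewrite !mem_enum => eF2; rewrite (disjointFl dF eF2).
- exact: enum_uniq.
- by move=> e; rewrite mem_cat !mem_enum inE.
Qed.

(** * Balanced orientations, by removal of pendant edges and cycles *)

(** Prolong the path at its front while its first vertex has a predecessor outside it; as its
    vertices are distinct, [#|V|] bounds its length. *)
Lemma maximal_path (V : finType) (e : rel V) (x : V) (p : seq V) :
  uniq (x :: p) -> path e x p -> p != [::] ->
  exists y q, [/\ uniq (y :: q), path e y q, q != [::] &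
    forall z, e z y -> z \in y :: q].
Proof.
have [n] := ubnP (#|V| - size p); elim: n => // n IH in x p *.
rewrite ltnS => le_n up pp p0.
have [/existsP[z /andP[ezx zp]]|/existsPn noz] :=
  boolP [exists z, e z x && (z \notin x :: p)].
  apply: (IH z (x :: p)) => //=; last by rewrite ezx.
    have: (size (x :: p) <= #|V|)%N by rewrite -(card_uniqP up) max_card.
    by move=> /= ltp; apply: leq_trans (ltn_sub2l ltp (ltnSn _)) le_n.
  by rewrite zp.
exists x, p; split=> // z ezx; apply: contraT => zp.
by have := noz z; rewrite ezx zp.
Qed.

(** Take a path that cannot be prolonged before its first vertex [x], so that all neighbours of [x]
    lie on it. If the successor [y] of [x] is the only one, [x] is pendant. Another neighbour [z]
    closes the segment from [x] to [z] into a cycle, of length at least three because [z] comes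
    after [y]. *)
Lemma leaf_or_cycle (V : finType) (F : {set {set V}}) :
  (forall e, e \in F -> #|e| = 2%N) -> F != set0 ->
  (exists x y, [/\ x != y, [set x; y] \in F &
     forall e, e \in F -> x \in e -> e = [set x; y]]) \/
  (exists c : seq V, [/\ uniq c, (2 < size c)%N &
     forall x, x \in c -> [set x; next c x] \in F]).
Proof.
move=> F2 /set0Pn[e0 e0F].
pose e : rel V := fun x y => [set x; y] \in F.
have esym x y : e x y = e y x by rewrite /e setUC.
have eirr x : e x x = false.
  by apply/negP => /F2; rewrite setUid cards1.
have /cards2P[a [b [ab e0E]]] : #|e0| == 2%N by rewrite F2.
have uab : uniq [:: a; b] by rewrite /= inE ab.
have pab : path e a [:: b] by rewrite /= andbT /e -e0E.
have [x [[|y q] [uq pq // _ xmax]]] := maximal_path uab pab isT.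
have exy : e x y by case/andP: pq.
have nxy : x != y by apply: contraTneq exy => ->; rewrite eirr.
have [/existsP[z /andP[ezx zy]]|/existsPn noz] :=
  boolP [exists z, e z x && (z != y)].
  right; have := xmax _ ezx; rewrite !inE (negPf zy) /=.
  case/orP => [/eqP zx|]; first by rewrite zx eirr in ezx.
  move=> zq; case/splitPr: zq uq pq xmax => q1 q2 uq pq _.
  exists (x :: y :: rcons q1 z); split.
  - move: uq; rewrite -cat_rcons -!cat_cons cat_uniq.
    by case/andP.
  - by rewrite /= size_rcons.
  move=> t tc; have := @next_cycle _ e (x :: y :: rcons q1 z) t _ tc; apply.
  rewrite /= rcons_path last_rcons ezx andbT.
  by move: pq; rewrite -cat_rcons /= cat_path => /and3P[-> -> _].
left; exists x, y; split=> // f fF xf.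
have /cards2P[c [d [cd fE]]] : #|f| == 2%N by rewrite F2.
wlog xE : c d cd fE / x = c => [hw|].
  have /orP[/eqP xE|/eqP xE] : (x == c) || (x == d).
  - by move: xf; rewrite fE !inE.
  - exact: (hw c d).
  by apply: (hw d c); rewrite // 1?eq_sym // setUC.
have /eqP dy : d == y.
  by have := noz d; rewrite esym xE /e -fE fF /= negbK.
by rewrite fE xE dy.
Qed.

(** A cycle of length at least three never runs back along the edge just used; this keeps its edges
    pairwise distinct. *)
Lemma next_next_neq (T : eqType) (c : seq T) (x : T) :
  uniq c -> (2 < size c)%N -> x \in c -> next c (next c x) != x.
Proof.
move=> uc sc xc; have [i c' cE] := rot_to xc.
rewrite -!(next_rot i uc) cE.
have: uniq (rot i c) by rewrite rot_uniq.
have: (2 < size (rot i c))%N by rewrite size_rot.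
rewrite cE; case: c' {cE} => [//|y [//|z s]] _ /= /andP[].
rewrite !inE !negb_or eqxx => /and3P[xy xz _] _.
by rewrite [y == x]eq_sym (negPf xy) eqxx eq_sym.
Qed.

(** As [s] has no repetition, [v] selects a single entry of [ls], and the sum equals that label. *)
Lemma sum_zip_indicator (R : realFieldType) (T : eqType) (s : seq T)
    (ls : seq R) (v : T) (a b : R) :
  uniq s -> size ls = size s -> v \in s ->
  (forall l, l \in ls -> a <= l <= b) ->
  a <= \sum_(x <- zip s ls) (x.1 == v)%:R * x.2 <= b.
Proof.
move=> us ss vs lab.
have -> : \sum_(x <- zip s ls) (x.1 == v)%:R * x.2 = ls`_(index v s).
  elim: s ls us ss vs {lab} => [|y s IH] [|l ls] //= /andP[ys us] [ss].
  rewrite big_cons inE eq_sym; case: (eqVneq y v) => [<- _|ny /= vs] /=.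
    rewrite big1_seq ?addr0 ?mul1r // => [[z m]] /= zs.
    suff /negPf-> : z != y by rewrite mul0r.
    apply: contraNneq ys => <-.
    by have := map_f fst zs; rewrite -/(unzip1 _) unzip1_zip ?ss.
  by rewrite mul0r add0r IH.
by apply: lab; rewrite mem_nth // ss index_mem.
Qed.

(* A pendant edge takes the smallest label, directed against the sum already
   present at its inner end. If there is none, a simple cycle, cyclically
   directed, takes the k largest labels and contributes at most
   [ls`_0 - ls`_(k - 1)], while the other edges contribute at most [ls`_k]. *)
Lemma balanced_orientation (R : realFieldType) (V : finType)
    (F : {set {set V}}) (ls : seq R) :
  (forall e, e \in F -> #|e| = 2%N) -> size ls = #|F| ->
  sorted >=%R ls -> (forall l, l \in ls -> 0 <= l) ->
  exists T : seq (V * V * R), [/\ orients T F, perm_eq (map snd T) ls &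
    forall v, `|net_sum T v| <= ls`_0].
Proof.
have [n] := ubnP #|F|; elim: n => // n IH in F ls *.
rewrite ltnS => le_n F2 sz srt pos.
have [F0|Fn0] := eqVneq F set0.
  (* Without edges [ls] is empty, and its head takes the default value 0, which bounds the empty
     sums. *)
  exists [::]; move: sz; rewrite F0 cards0 => /size0nil ->; split=> //.
    by rewrite /orients enum_set0.
  by move=> v; rewrite /net_sum big_nil normr0.
case: (leaf_or_cycle F2 Fn0) => [[x [y [xy xyF xleaf]]]|[c [uc sc cF]]].
  have Fx : F = (F :\ [set x; y]) :|: [set [set x; y]] by rewrite setUC setD1K.
  have szF : #|F| = #|F :\ [set x; y]|.+1 by rewrite (cardsD1 [set x; y]) xyF.
  case/lastP: ls => [|ls l] in sz srt pos *; first by rewrite szF in sz.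
  have srt' : sorted >=%R ls.
    by move: srt; rewrite -cats1 => /cat_sorted2[].
  have [|||||T [oT pT bT]] := IH (F :\ [set x; y]) ls.
  - by rewrite -ltnS -szF.
  - by move=> e; rewrite !inE => /andP[_ /F2].
  - by move: sz; rewrite size_rcons szF => -[].
  - by [].
  - by move=> m mls; apply: pos; rewrite mem_rcons inE mls orbT.
  have l0 : 0 <= l by apply: pos; rewrite mem_rcons inE eqxx.
  have lsl m : m \in ls -> l <= m.
    move: srt; rewrite -cats1 sorted_pairwise; last exact: ge_trans.
    by rewrite pairwise_cat => /and3P[/allrelP+ _ _] mls; apply=> //; rewrite inE.
  (* If [ls] is empty, the inductive bound is the default value 0, still at most [l]. *)
  have [ls0 lsl0] : ls`_0 <= (rcons ls l)`_0 /\ l <= (rcons ls l)`_0.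
    by case: (ls) lsl => [|m ls'] //= lsl; split=> //; apply: lsl; rewrite inE eqxx.
  (* The arc subtracts [l] from a nonnegative sum at [y] and adds it to a negative one, so the new
     absolute value is at most the larger of the old one and [l]. *)
  pose a : V * V := if 0 <= net_sum T y then (y, x) else (x, y).
  have xT0 : net_sum T x = 0.
    apply: (net_sum_notin oT) => e; rewrite !inE => /andP[ne eF].
    by apply: contra ne => /(xleaf _ eF) ->.
  exists (T ++ [:: (a, l)]); split.
  - rewrite Fx; apply: orients_cat => //.
      rewrite /orients enum_set1 /arc_ends /a /=.
      by case: ifP => _ //=; rewrite setUC.
    by rewrite disjoint_sym disjoints1 !inE eqxx.
  - by rewrite map_cat /= cats1 -!cats1 perm_cat2r.
  move=> v; rewrite net_sum_cat net_sum1 /=.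
  have yx : (y == x) = false by rewrite eq_sym (negPf xy).
  have [->|nvx] := eqVneq v x.
    rewrite xT0 /a; case: ifP => _ /=; rewrite eqxx ?yx /=;
    by rewrite add0r ?subr0 ?sub0r ?mul1r ?mulN1r ?normrN ger0_norm.
  have [->|nvy] := eqVneq v y.
    have := bT y; rewrite /a; case: (lerP 0 (net_sum T y)) => s0 /=;
    rewrite eqxx (negPf xy) /= !ler_norml => /andP[? ?]; apply/andP; split; lra.
  apply: (le_trans _ ls0); apply: (le_trans _ (bT v)).
  rewrite /a; case: ifP => _ /=; rewrite ![_ == v]eq_sym (negPf nvx) (negPf nvy);
  by rewrite subrr mul0r addr0.
pose C := [set [set x; next c x] | x in c].
(* Two vertices of the cycle could yield the same edge only in opposite directions, and then two
   steps of [next] would return to the start. *)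
have injC : {in c &, injective (fun x => [set x; next c x])}.
  move=> x y xc yc /setP E.
  have := E x; have := E (next c x); rewrite !inE !eqxx orbT /=.
  move=> /esym/orP[/eqP nE|/eqP nE] /esym/orP[/eqP//|/eqP xE].
    by have := next_next_neq uc sc yc; rewrite -xE nE eqxx.
  by rewrite -(prev_next uc x) nE prev_next.
have sC : #|C| = size c.
  by rewrite card_in_imset // (card_uniqP uc).
have CF : C \subset F by apply/subsetP => e /imsetP[x xc ->]; apply: cF.
have FE : F = C :|: (F :\: C).
  by rewrite setDE setUIr setUCr setIT; apply/esym/setUidPr.
have szF : #|F| = (size c + #|F :\: C|)%N.
  by rewrite -sC -(cardsID C F) (setIidPr CF).
pose l1 := take (size c) ls; pose l2 := drop (size c) ls.
have lsE : ls = l1 ++ l2 by rewrite cat_take_drop.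
have sl1 : size l1 = size c by rewrite size_takel // sz szF leq_addr.
have [srt1 srt2] : sorted >=%R l1 /\ sorted >=%R l2.
  by move: srt; rewrite lsE => /cat_sorted2[].
have [|||||T [oT pT bT]] := IH (F :\: C) l2.
- by move: le_n; rewrite szF; move: sc; case: (size c) => // k _; apply: leq_trans;
    rewrite addSn ltnS leq_addl.
- by move=> e; rewrite !inE => /andP[_ /F2].
- by rewrite size_drop sz szF addKn.
- by [].
- by move=> m ml; apply: pos; rewrite lsE mem_cat ml orbT.
pose T0 := zip [seq (x, next c x) | x <- c] l1.
have oT0 : orients T0 C.
  rewrite /orients -[map _ _]/(map ((fun a => [set a.1; a.2]) \o fst) T0).
  rewrite map_comp -/(unzip1 T0) unzip1_zip ?size_map ?sl1 // -map_comp.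
  apply: uniq_perm; rewrite ?enum_uniq ?map_inj_in_uniq //.
  by move=> e; rewrite mem_enum; apply/mapP/imsetP => -[x xc ->]; exists x.
(* This separates the label entering [v] along the cycle from the one leaving it. The induction
   replaces [next c] by an arbitrary [f], since the successor map must not change as the list
   shrinks. *)
have sumT0 v : net_sum T0 v = \sum_(x <- zip (map (next c) c) l1) (x.1 == v)%:R * x.2
    - \sum_(x <- zip c l1) (x.1 == v)%:R * x.2.
  rewrite /net_sum /T0.
  elim: (c) (l1) {oT0 sl1 lsE srt1} (next c) => [|y s IHs] [|m l] f //=;
    rewrite ?big_nil ?subrr // !big_cons IHs /=; lra.
exists (T0 ++ T); split.
- rewrite FE; apply: orients_cat => //.
  by rewrite disjoint_sym disjoints_subset; apply/subsetP => e; rewrite !inE => /andP[].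
- rewrite map_cat lsE; apply: perm_cat => //.
  by rewrite -/(unzip2 T0) unzip2_zip // size_map sl1.
move=> v; rewrite net_sum_cat.
have l1E : l1 = ls`_0 :: behead l1.
  by rewrite lsE; case: (l1) sl1 => // /esym s0; rewrite s0 in sc.
have l1b m : m \in l1 -> last 0 l1 <= m <= ls`_0.
  move=> ml; move: srt1; rewrite sorted_pairwise; last exact: ge_trans.
  move=> pw; apply/andP; split.
    case/lastP: (l1) ml pw => // s z; rewrite last_rcons mem_rcons inE.
    case/orP => [/eqP->//|ms]; rewrite -cats1 pairwise_cat.
    by case/and3P => /allrelP+ _ _; apply=> //; rewrite inE.
  move: ml pw; rewrite l1E inE => /orP[/eqP->//|ms] /= /andP[/allP/(_ _ ms)].
  by [].
(* The inductive bound for the other edges is below the smallest cycle label; when [l2] is empty, it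
   is the default value 0. *)
have l21 : l2`_0 <= last 0 l1.
  move: srt; rewrite lsE sorted_pairwise; last exact: ge_trans.
  rewrite pairwise_cat => /and3P[/allrelP r _ _].
  have ll1 : last 0 l1 \in l1 by rewrite l1E /= mem_last.
  case: (l2) r => [|m s] r /=; last by apply: r => //; rewrite inE eqxx.
  by apply: pos; rewrite lsE mem_cat ll1.
have [vc|vc] := boolP (v \in c); last first.
  have -> : net_sum T0 v = 0.
    apply: (net_sum_notin oT0) => e /imsetP[x xc ->].
    rewrite !inE negb_or; apply/andP; split; apply: contraNneq vc => -> //.
    by rewrite mem_next.
  rewrite add0r; apply: (le_trans (bT v)); apply: (le_trans l21).
  by have /l1b/andP[] : ls`_0 \in l1 by rewrite l1E inE eqxx.
have u1 : uniq (map (next c) c).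
  by rewrite map_inj_uniq //; apply: can_inj (prev_next uc).
have v1 : v \in map (next c) c.
  by apply/mapP; exists (prev c v); rewrite ?mem_prev ?next_prev.
(* On the cycle, both labels at [v] lie between [last 0 l1] and the head of [ls], so their
   difference leaves a margin of [last 0 l1], enough for the contribution of [T] by [l21]. *)
have := sum_zip_indicator u1 _ v1 l1b; rewrite size_map => /(_ sl1) /andP[a1 a2].
have /andP[b1 b2] := sum_zip_indicator uc sl1 vc l1b.
have := bT v; rewrite sumT0 !ler_norml => /andP[c1 c2].
apply/andP; split; lra.
Qed.

(** * Distinct sums by relabelling, and lists of arcs with prescribed directions *)

(** Give the labels in increasing order to the elements sorted by [p]: a weakly increasing term plus
    a strictly increasing one is strictly increasing. *)
Lemma injective_relabelling (R : realFieldType) (T : eqType) (s : seq T)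
    (ls : seq R) (p : T -> R) :
  uniq s -> uniq ls -> size ls = size s ->
  exists h : T -> R, perm_eq (map h s) ls /\
    {in s &, injective (fun v => p v + h v)}.
Proof.
move=> us uls sz.
pose s' := sort (relpre p <=%R) s; pose l' := sort <=%R ls.
pose h v := l'`_(index v s').
have sz' : size l' = size s' by rewrite !size_sort.
have srt : sorted (relpre p <=%R) s' by apply: sort_sorted => x y; apply: le_total.
have lsrt : sorted <%R l' by rewrite sort_lt_sorted.
exists h; split.
  have ps : perm_eq s s' by rewrite perm_sym perm_sort.
  apply: (perm_trans (perm_map h ps)).
  suff -> : map h s' = l' by rewrite perm_sort.
  apply: (@eq_from_nth _ 0); rewrite size_map ?sz' // => i lti.
  case: s' => [|x0 s''] in ps h sz' srt lti *; first by [].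
  by rewrite (nth_map x0) // /h index_uniq // -(perm_uniq ps).
have key v w : v \in s -> w \in s -> (index v s' < index w s')%N ->
    p v + h v < p w + h w.
  move=> vs ws ltvw; apply: ler_ltD.
    apply: (sorted_ltn_index _ srt); rewrite ?mem_sort //.
    by move=> x y z; apply: le_trans.
  by rewrite /h lt_sorted_ltn_nth // inE sz' index_mem mem_sort.
move=> v w vs ws /= E.
case: (ltngtP (index v s') (index w s')) => [/key|/key|].
- by move=> /(_ vs ws); rewrite E ltxx.
- by move=> /(_ ws vs); rewrite E ltxx.
by apply: index_inj; rewrite ?mem_sort.
Qed.

Lemma net_sum_in (R : realFieldType) (V : finType) (T : seq (V * V * R))
    (v : V) :
  (forall x, x \in T -> x.1.1 != v) ->
  net_sum T v = \sum_(x <- T | x.1.2 == v) x.2.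
Proof.
move=> nT; rewrite /net_sum [RHS]big_mkcond; apply: eq_big_seq => x /nT /negPf->.
by rewrite subr0; case: eqP; rewrite ?mul1r ?mul0r.
Qed.

Lemma net_sum_out (R : realFieldType) (V : finType) (T : seq (V * V * R))
    (v : V) :
  (forall x, x \in T -> x.1.2 != v) ->
  net_sum T v = - \sum_(x <- T | x.1.1 == v) x.2.
Proof.
move=> nT; rewrite /net_sum -sumrN [RHS]big_mkcond.
apply: eq_big_seq => x /nT /negPf->.
by rewrite sub0r mulNr; case: eqP; rewrite ?mul1r ?mul0r ?oppr0.
Qed.

Lemma orients_map (R : realFieldType) (V : finType) (A : {set V})
    (a : V -> V * V) (h : V -> R) :
  {in A &, injective (fun v => [set (a v).1; (a v).2])} ->
  orients [seq (a v, h v) | v <- enum A]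
    [set [set (a v).1; (a v).2] | v in A].
Proof.
move=> inja; rewrite /orients -map_comp; apply: uniq_perm.
- rewrite map_inj_in_uniq ?enum_uniq // => x y.
  by rewrite !mem_enum; apply: inja.
- exact: enum_uniq.
move=> e; rewrite mem_enum; apply/mapP/imsetP => -[x xA ->]; exists x => //.
  by rewrite -mem_enum.
by rewrite mem_enum.
Qed.

(** For edges where only the direction, recorded by [P], matters: the labels are dealt out along the
    enumeration of [F]. *)
Lemma orients_exists (R : realFieldType) (V : finType) (F : {set {set V}})
    (P : V -> V -> Prop) (ls : seq R) :
  (forall e, e \in F -> exists u v, P u v /\ e = [set u; v]) ->
  size ls = #|F| ->
  exists T : seq (V * V * R), [/\ orients T F, map snd T = ls &
    forall x, x \in T -> P x.1.1 x.1.2].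
Proof.
move=> PF; rewrite cardE => sz.
have {}PF e : e \in enum F -> exists u v, P u v /\ e = [set u; v].
  by rewrite mem_enum; apply: PF.
suff [T [TE lE TP]] : exists T : seq (V * V * R),
    [/\ map (@arc_ends R V) T = enum F, map snd T = ls &
      forall x, x \in T -> P x.1.1 x.1.2].
  by exists T; split=> //; rewrite /orients TE.
elim: (enum F) ls sz PF => [|e s IH] [|l ls] //= => [_ _|[sz] PF].
  by exists [::].
have [|T [TE lE TP]] := IH ls sz.
  by move=> f fs; apply: PF; rewrite inE fs orbT.
have [|u [v [Puv eE]]] := PF e; first by rewrite inE eqxx.
exists ((u, v, l) :: T); split=> /=; rewrite ?TE ?lE ?eE //.
by move=> x; rewrite inE => /orP[/eqP->|/TP].
Qed.

Lemma cards_disjointU (T : finType) (A B : {set T}) :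
  [disjoint A & B] -> #|A :|: B| = (#|A| + #|B|)%N.
Proof. by move=> dAB; rewrite cardsU (disjoint_setI0 dAB) cards0 subn0. Qed.

(** * From lists of arcs to an orientation and a labelling *)

Lemma mem_edge_set (G : sgraph) (x y : G) :
  ([set x; y] \in edge_set G) = adj x y.
Proof.
apply/imsetP/idP => [[[a b]]|xy]; last by exists (x, y); rewrite ?inE.
rewrite inE /= => ab E.
have /orP[/eqP xa|/eqP xb] : (x == a) || (x == b) by rewrite -in_set2 -E set21.
  have /orP[/eqP bx|/eqP <-] : (b == x) || (b == y) by rewrite -in_set2 E set22.
    by rewrite bx xa adj_irrefl in ab.
  by rewrite xa.
have /orP[/eqP ax|/eqP <-] : (a == x) || (a == y) by rewrite -in_set2 E set21.
  by rewrite ax xb adj_irrefl in ab.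
by rewrite xb adj_sym.
Qed.

Lemma edge_setP (G : sgraph) (e : {set G}) :
  e \in edge_set G -> exists x y, adj x y /\ e = [set x; y].
Proof. by case/imsetP=> [[x y]]; rewrite inE; exists x, y. Qed.

Lemma uniq_map_inj (T1 T2 : eqType) (f : T1 -> T2) (s : seq T1) :
  uniq (map f s) -> {in s &, injective f}.
Proof.
elim: s => //= z s IH /andP[zs us] x y; rewrite !inE.
move=> /orP[/eqP->|xs] /orP[/eqP->|ys] // E; last exact: IH.
  by rewrite E map_f in zs.
by rewrite -E map_f in zs.
Qed.

(** Each edge is the pair of ends of a unique arc of [T], from which its direction and label are
    read. The labels in [T] are distinct, so the labelling is injective, and equal cardinalities
    make it bijective. *)
Lemma antimagic_of_arcs (R : realType) (G : sgraph) (L : {fset R})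
    (T : seq (G * G * R)) :
  orients T (edge_set G) -> perm_eq (map snd T) L -> injective (net_sum T) ->
  exists (D : orientation G) (tau : edge G -> L),
    bijective tau /\ injective (vertex_sum D (fun a => val (tau a))).
Proof.
move=> oT pT injT.
have memT (a : edge G) : val a \in map (@arc_ends R G) T.
  by rewrite (perm_mem oT) mem_enum (valP a).
have uT : uniq (map (@arc_ends R G) T) by rewrite (perm_uniq oT) enum_uniq.
have uL : uniq (map snd T) by rewrite (perm_uniq pT) fset_uniq.
have arcP (a : edge G) : {x | x \in T & val a = arc_ends x}.
  have [|x xT /eqP xE] := @sig2W _ (fun x => x \in T) (fun x => val a == arc_ends x).
    by have /mapP[x xT ->] := memT a; exists x.
  by exists x.
pose arc a := s2val (arcP a).
have arcT a : arc a \in T := s2valP (arcP a).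
have arcE a : val a = arc_ends (arc a) := s2valP' (arcP a).
pose D := @Orientation G (fun a => (arc a).1.1) (fun a => (arc a).1.2) arcE.
have labL a : (arc a).2 \in L by rewrite -(perm_mem pT) map_f.
pose tau (a : edge G) : L := [` labL a]%fset.
have arc_inj : injective arc.
  by move=> a b ab; apply: val_inj; rewrite !arcE ab.
(* The chosen arcs exhaust [T], which turns sums over edges into sums over [T]. *)
have permT : perm_eq (map arc (enum (edge G))) T.
  apply: uniq_perm.
  - by rewrite map_inj_uniq // enum_uniq.
  - exact: map_uniq uT.
  move=> x; apply/mapP/idP => [[a _ ->] //|xT].
  have xE : arc_ends x \in edge_set G := orients_mem oT xT.
  exists (Sub (arc_ends x) xE : edge G); first by rewrite mem_enum.
  by apply: (uniq_map_inj uT) => //; rewrite -arcE.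
have sumE (P : pred (G * G * R)) :
    \sum_(a : edge G | P (arc a)) (arc a).2 = \sum_(x <- T | P x) x.2.
  by rewrite -(perm_big _ permT) big_map big_enum_cond.
exists D, tau; split.
  apply: inj_card_bij.
    move=> a b /(congr1 val) /= ab; apply: arc_inj.
    exact: (uniq_map_inj uL).
  rewrite -cardfE -(perm_size pT) size_map -(size_map (@arc_ends R G)).
  by rewrite (perm_size oT) -cardE card_sig.
suff E : vertex_sum D (fun a => val (tau a)) =1 net_sum T.
  by move=> u v; rewrite !E; apply: injT.
move=> v; rewrite /vertex_sum /= (sumE (fun x => x.1.2 == v)).
rewrite (sumE (fun x => x.1.1 == v)) /net_sum [in LHS]big_mkcond.
rewrite [X in _ - X]big_mkcond /= -sumrB; apply: eq_bigr => x _.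
by rewrite mulrBl; do 2!case: eqP => _; rewrite ?mul1r ?mul0r.
Qed.

(** * Centres of a graph of radius two *)

(** A form of eccentricity at most two that exhibits the middle vertex of each walk. *)
Definition within_two (G : sgraph) (x : G) : bool :=
  [forall y, [|| x == y, adj x y | [exists u, adj x u && adj u y]]].

Lemma radius_two_center (G : sgraph) :
  connected G -> radius G = 2%N -> exists x : G, within_two x.
Proof.
move=> conn rad.
have dist_le (x y : G) : (dist x y <= #|G|)%N.
  by rewrite -[leqRHS](size_iota 0) find_size.
have [x ex] : exists x : G, (eccentricity x <= 2)%N.
  have : radius G = #|G| \/ exists x : G, eccentricity x = radius G.
    apply: (big_ind (fun t => t = #|G| \/ exists x : G, eccentricity x = t)).
    - by left.
    - by move=> a b Pa Pb; case: leqP.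
    move=> x _.
    by right; exists x.
  (* If the minimum is the default value, then [#|G|] is two, which already bounds every
     distance. *)
  rewrite rad => -[cG|[x <-]]; last by exists x.
  have /card_gt0P[x _] : (0 < #|G|)%N by rewrite -cG.
  by exists x; rewrite cG; apply/bigmax_leqP.
exists x; apply/forallP => y.
(* A path without repeated vertices is shorter than [#|G|], so the search in [dist] succeeds and
   yields a walk of length [dist x y]. *)
have walk : has (walk_of_length x y) (iota 0 #|G|).
  have /connectP[p0 pp0 yE] := conn x y.
  case/shortenP: pp0 yE => p pp up _ yE; apply/hasP; exists (size p).
    rewrite mem_iota /= add0n.
    by rewrite -[X in (X <= _)%N]/(size (x :: p)) -(card_uniqP up) max_card.
  by apply/existsP; exists (in_tuple p); rewrite /= pp yE eqxx.
have := nth_find 0%N walk; have := walk; rewrite has_find size_iota => lt.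
rewrite nth_iota // add0n.
have : (dist x y <= 2)%N by apply: leq_trans ex; apply: leq_bigmax.
rewrite /dist; case: (find _ _) => [|[|[|//]]] _ /existsP[] [] [|a [|b [|//]]] //= _;
  rewrite ?andbT.
- by move->.
- by case/andP => xa /eqP<-; rewrite xa orbT.
case/andP => /andP[xa ab] /eqP<-; apply/orP; right; apply/orP; right.
by apply/existsP; exists a; rewrite xa.
Qed.

(** * Partition of the edges around a root *)

Definition neighbors (G : sgraph) (x : G) : {set G} := [set y | adj x y].

(** Under [within_two r], these are the vertices at distance exactly two from [r]. *)
Definition far (G : sgraph) (r : G) : {set G} := [set v | (v != r) && ~~ adj r v].

Definition star_edges (G : sgraph) (r : G) : {set {set G}} :=
  [set [set u; r] | u in neighbors r].

Definition tree_edges (G : sgraph) (r : G) (f : G -> G) : {set {set G}} :=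
  [set [set f v; v] | v in far r].

Definition inner_edges (G : sgraph) (r : G) : {set {set G}} :=
  [set e in edge_set G | (e \subset neighbors r) || (e \subset far r)].

(** Taking the complement makes the classes cover all edges at once; that these edges join
    [neighbors r] to [far r] is then derived. *)
Definition cross_edges (G : sgraph) (r : G) (f : G -> G) : {set {set G}} :=
  edge_set G :\: (star_edges r :|: (tree_edges r f :|: inner_edges r)).

Lemma cross_edgesP (G : sgraph) (r : G) (f : G -> G) (e : {set G}) :
  e \in cross_edges r f ->
  exists u v, [/\ u \in neighbors r, v \in far r & adj u v] /\ e = [set u; v].
Proof.
rewrite inE !in_setU !negb_or => /andP[/and3P[es _ ei] eE].
have [x [y [xy exy]]] := edge_setP eE.
have nr (a b : G) : adj a b -> e = [set a; b] -> b != r.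
  move=> ab eab; apply: contraNneq es => br; apply/imsetP.
  by exists a; rewrite ?eab ?br // inE adj_sym -br.
have yr := nr _ _ xy exy.
have xr : x != r by apply: (nr y); rewrite 1?adj_sym // exy setUC.
move: ei; rewrite inE eE negb_or /= exy.
rewrite !subUset !sub1set !inE xr yr /=.
case: (boolP (adj r x)) (boolP (adj r y)) => rx [] ry //= _.
  by exists x, y; rewrite !inE rx yr ry.
by exists y, x; rewrite !inE ry xr rx adj_sym setUC.
Qed.

(** A star edge contains [r], unlike tree and inner edges; a tree edge meets both [neighbors r] and
    [far r], unlike an inner edge; cross edges avoid the other classes by definition. *)
Lemma disjoint_edge_classes (G : sgraph) (r : G) (f : G -> G) :
  (forall v, v \in far r -> f v \in neighbors r) ->
  [/\ [disjoint star_edges r &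
         tree_edges r f :|: (cross_edges r f :|: inner_edges r)],
      [disjoint tree_edges r f & cross_edges r f :|: inner_edges r] &
      [disjoint cross_edges r f & inner_edges r]].
Proof.
move=> fN.
have rN : r \notin neighbors r by rewrite inE adj_irrefl.
have rF : r \notin far r by rewrite inE eqxx.
have NF u : u \in neighbors r -> u \notin far r.
  by rewrite !inE => ->; rewrite andbF.
split.
- rewrite disjoints_subset; apply/subsetP => e eS.
  have /imsetP[u uN eE] := eS.
  have re : r \in e by rewrite eE set22.
  rewrite inE !in_setU !negb_or; apply/and3P; split.
  + apply: contraTN re => /imsetP[v vF ->]; rewrite !inE negb_or.
    apply/andP; split; first by apply: contraNneq rN => {1}->; apply: fN.
    by apply: contraNneq rF => {1}->.
  + by rewrite inE in_setU eS.
  + rewrite inE negb_and negb_or; apply/orP; right; apply/andP; split.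
      by apply: contra rN => /subsetP; apply.
    by apply: contra rF => /subsetP; apply.
- rewrite disjoints_subset; apply/subsetP => e eT.
  have /imsetP[v vF eE] := eT.
  rewrite inE !in_setU !negb_or; apply/andP; split.
    by rewrite inE !in_setU eT orbT.
  rewrite inE negb_and negb_or eE !subUset !sub1set.
  apply/orP; right; apply/andP; split.
    by rewrite negb_and; apply/orP; right; apply: contraL vF => /NF.
  by rewrite negb_and NF // fN.
- rewrite disjoints_subset; apply/subsetP => e.
  rewrite [e \in cross_edges r f]inE !in_setU !negb_or.
  by case/andP=> /and3P[_ _ ei] _; rewrite inE.
Qed.

Lemma edge_classesU (G : sgraph) (r : G) (f : G -> G) :
  (forall v, v \in far r -> adj (f v) v) ->
  edge_set G = star_edges r :|:
    (tree_edges r f :|: (cross_edges r f :|: inner_edges r)).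
Proof.
move=> fv; apply/setP => e; rewrite !in_setU [e \in cross_edges r f]inE !in_setU.
have [|_] := boolP (e \in star_edges r) => /=.
  by case/imsetP=> u; rewrite inE => ru ->; rewrite mem_edge_set adj_sym.
have [|_] := boolP (e \in tree_edges r f) => /=.
  by case/imsetP=> v vF ->; rewrite mem_edge_set fv.
have [|_] := boolP (e \in inner_edges r) => /=; last by rewrite orbF.
by rewrite inE => /andP[->].
Qed.

(** * Bounds and values of vertex sums for families of arcs *)

Lemma net_sum_le_count (R : realFieldType) (V : finType) (m : R)
    (T : seq (V * V * R)) (v : V) :
  (forall x, x \in T -> x.1.1 != v) -> (forall x, x \in T -> x.2 <= m) ->
  net_sum T v <= m *+ count (fun x => x.1.2 == v) T.
Proof.
move=> nT mT; rewrite net_sum_in // -[_ *+ _]addr0 -iter_addr -big_const_seq.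
rewrite big_seq_cond [leRHS]big_seq_cond; apply: ler_sum => x /andP[/mT].
by [].
Qed.

(** Two arcs into [v] with the same tail would have the same ends, but no edge is repeated; so the
    tails are distinct elements of [A]. *)
Lemma count_heads_le (R : realFieldType) (V : finType) (A : {set V})
    (F : {set {set V}}) (T : seq (V * V * R)) (v : V) :
  orients T F -> (forall x, x \in T -> x.1.2 = v -> x.1.1 \in A) ->
  (count (fun x => x.1.2 == v) T <= #|A|)%N.
Proof.
move=> oT TA; rewrite -size_filter cardE.
rewrite -(size_map (fun x => x.1.1)); apply: uniq_leq_size; last first.
  move=> u /mapP[x]; rewrite mem_filter => /andP[/eqP xv xT] ->.
  by rewrite mem_enum TA.
have uT : uniq (map (@arc_ends R V) T) by rewrite (perm_uniq oT) enum_uniq.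
rewrite map_inj_in_uniq ?filter_uniq ?(map_uniq uT) // => x y.
rewrite !mem_filter => /andP[/eqP xv xT] /andP[/eqP yv yT] xy.
by apply: (uniq_map_inj uT); rewrite // /arc_ends xv yv xy.
Qed.

Lemma net_sum_map_heads (R : realFieldType) (V : finType) (A : {set V})
    (f : V -> V) (h : V -> R) (v : V) :
  v \in A -> (forall w, w \in A -> f w != v) ->
  net_sum [seq ((f w, w), h w) | w <- enum A] v = h v.
Proof.
move=> vA fA; rewrite /net_sum big_map big_enum /= (bigD1 v) //= eqxx.
rewrite (negPf (fA v vA)) subr0 mul1r big1 ?addr0 // => w /andP[wA wv].
by rewrite (negPf wv) (negPf (fA w wA)) subr0 mul0r.
Qed.

Lemma net_sum_map_tails (R : realFieldType) (V : finType) (A : {set V})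
    (r : V) (h : V -> R) (v : V) :
  v \in A -> v != r ->
  net_sum [seq ((w, r), h w) | w <- enum A] v = - h v.
Proof.
move=> vA vr; rewrite /net_sum big_map big_enum /= (bigD1 v) //= eqxx.
rewrite eq_sym (negPf vr) sub0r mulN1r big1 ?addr0 // => w /andP[wA wv].
by rewrite (negPf wv) subr0 mul0r.
Qed.

Lemma net_sum_map_center (R : realFieldType) (V : finType) (A : {set V})
    (r : V) (h : V -> R) :
  r \notin A -> net_sum [seq ((w, r), h w) | w <- enum A] r = \sum_(w in A) h w.
Proof.
move=> rA; rewrite /net_sum big_map big_enum /=; apply: eq_bigr => w wA.
by rewrite eqxx (negPf (memPn rA w wA)) subr0 mul1r.
Qed.

(** * The antimagic construction at a centre of maximum degree *)

Lemma antimagic_arcs (R : realFieldType) (G : sgraph) (r : G) (ls : seq R) :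
  within_two r ->
  (forall x : G, within_two x -> (#|neighbors x| <= #|neighbors r|)%N) ->
  size ls = #|edge_set G| -> sorted >%R ls -> (forall l, l \in ls -> 0 < l) ->
  exists T : seq (G * G * R), [/\ orients T (edge_set G),
    perm_eq (map snd T) ls & injective (net_sum T)].
Proof.
move=> r2 rmax sz srt pos.
have [f fP] : exists f : G -> G, forall v, v \in far r ->
    f v \in neighbors r /\ adj (f v) v.
  apply: (@fin_all_exists _ _ (fun v u => v \in far r ->
    u \in neighbors r /\ adj u v)) => v.
  have := forallP r2 v; case/or3P => [/eqP<-|rv|/existsP[u /andP[ru uv]]].
  - by exists r; rewrite inE eqxx.
  - by exists r; rewrite inE rv andbF.
  by exists u => _; rewrite inE.
have fN v : v \in far r -> f v \in neighbors r by case/fP.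
have fv v : v \in far r -> adj (f v) v by case/fP.
have [dS dT dC] := disjoint_edge_classes fN.
have EE := edge_classesU fv.
have rN : r \notin neighbors r by rewrite inE adj_irrefl.
have rF : r \notin far r by rewrite inE eqxx.
have NF u : u \in neighbors r -> u \notin far r.
  by rewrite !inE => ->; rewrite andbF.
have FN v : v \in far r -> v \notin neighbors r.
  by apply: contraL => /NF.
have neNF u v : u \in neighbors r -> v \in far r -> u != v.
  by move=> uN vF; apply: contraNneq (NF u uN) => ->.
have injS : {in neighbors r &, injective (fun u => [set (u, r).1; (u, r).2])}.
  move=> u w uN wN /= E.
  have: u \in [set w; r] by rewrite -E set21.
  by rewrite in_set2 => /orP[/eqP//|/eqP ur]; rewrite ur (negPf rN) in uN.
have injT : {in far r &, injective (fun v => [set (f v, v).1; (f v, v).2])}.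
  move=> v w vF wF /= E.
  have: v \in [set f w; w] by rewrite -E set22.
  rewrite in_set2 eq_sym => /orP[|/eqP//].
  by rewrite (negPf (neNF _ _ (fN w wF) vF)).
have cS : #|star_edges r| = #|neighbors r| := card_in_imset injS.
have cT : #|tree_edges r f| = #|far r| := card_in_imset injT.
(* Since [ls] is decreasing, each label of a block exceeds all labels of the later blocks. *)
have [l1 [l2 [l3 [l4 [lsE s1 s2 s3 s4]]]]] : exists l1 l2 l3 l4 : seq R,
    [/\ ls = l1 ++ l2 ++ l3 ++ l4, size l1 = #|neighbors r|,
      size l2 = #|far r|, size l3 = #|cross_edges r f| &
      size l4 = #|inner_edges r|].
  have split_seq (l : seq R) a b : size l = (a + b)%N ->
      exists la lb, [/\ l = la ++ lb, size la = a & size lb = b].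
    move=> sl; exists (take a l), (drop a l).
    by rewrite cat_take_drop size_drop size_takel sl ?addKn ?leq_addr.
  move: sz; rewrite EE !cards_disjointU // cS cT.
  move=> /split_seq[l1 [l' [-> s1 /split_seq[l2 [l'' [-> s2]]]]]].
  move=> /split_seq[l3 [l4 [-> s3 s4]]].
  by exists l1, l2, l3, l4.
have gtR_trans : transitive (>%R : rel R).
  by move=> y x z /= yx zy; apply: lt_trans zy yx.
have uls : uniq ls by apply: sorted_uniq srt => //; apply: ltxx.
have pw : pairwise >%R ls by rewrite -sorted_pairwise.
have [u1 u2] : uniq l1 /\ uniq l2.
  by move: uls; rewrite lsE !cat_uniq => /and3P[-> _ /and3P[-> _ _]].
have lt1 a b : a \in l1 -> b \in l2 ++ l3 ++ l4 -> b < a.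
  by move: pw; rewrite lsE pairwise_cat => /and3P[/allrelP h _ _]; apply: h.
have lt2 a b : a \in l2 -> b \in l3 ++ l4 -> b < a.
  move: pw; rewrite lsE !pairwise_cat => /and3P[_ _ /and3P[/allrelP h _ _]].
  exact: h.
have lt3 a b : a \in l3 -> b \in l4 -> b < a.
  move: pw; rewrite lsE !pairwise_cat.
  by move=> /and3P[_ _ /and3P[_ _ /and3P[/allrelP h _ _]]]; apply: h.
have srt4 : sorted >=%R l4.
  move: pw; rewrite lsE !pairwise_cat.
  move=> /and3P[_ _ /and3P[_ _ /and3P[_ _ pw4]]].
  apply: pairwise_sorted; apply: sub_pairwise pw4 => x y; exact: ltW.
have pos4 l : l \in l4 -> 0 <= l.
  by move=> ll; apply/ltW/pos; rewrite lsE !mem_cat ll !orbT.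
have inner2 e : e \in inner_edges r -> #|e| = 2%N.
  rewrite inE => /andP[/edge_setP[x [y [xy ->]]] _]; rewrite cards2.
  by have [E|//] := eqVneq x y; rewrite E adj_irrefl in xy.
have [Ti [oI pI bI]] := balanced_orientation inner2 s4 srt4 pos4.
set M := l4`_0 in bI.
have [Tc [oC pC PC]] := orients_exists (@cross_edgesP G r f) s3.
(* Without inner edges [M] is the default value 0, and positivity of the labels gives the bound. *)
have ltM l : l \in l1 ++ l2 ++ l3 -> M < l.
  rewrite /M => ll; have [->|[m [l4' l4E]]] : l4 = [::] \/ exists m l4', l4 = m :: l4'.
  - by case: (l4) => [|m l4']; [left | right; exists m, l4'].
  - by apply: pos; rewrite lsE !catA mem_cat -catA ll.
  have m4 : m \in l4 by rewrite l4E inE eqxx.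
  rewrite l4E /=; move: ll; rewrite !mem_cat => /or3P[ll|ll|ll].
  - by apply: lt1 ll _; rewrite !mem_cat m4 !orbT.
  - by apply: lt2 ll _; rewrite !mem_cat m4 !orbT.
  - exact: lt3 ll m4.
(* A vertex [v] of [far r] meets one tree arc, labelled [h v], and no star arc; its remaining sum
   comes from [Tc] and [Ti], which are already fixed. *)
have [h [ph injh]] := injective_relabelling (net_sum (Tc ++ Ti))
  (enum_uniq (far r)) u2 (etrans s2 (cardE _)).
pose Tt := [seq ((f v, v), h v) | v <- enum (far r)].
(* The star arc leaves [u], so the final sum at [u] is the opposite of [g u] plus the negated
   partial sum; hence the sign. *)
have [g [pg injg]] := injective_relabelling (fun u => - net_sum (Tt ++ Tc ++ Ti) u)
  (enum_uniq (neighbors r)) u1 (etrans s1 (cardE _)).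
pose Ts := [seq ((u, r), g u) | u <- enum (neighbors r)].
have hl v : v \in far r -> h v \in l2.
  by move=> vF; rewrite -(perm_mem ph) map_f // mem_enum.
have gl u : u \in neighbors r -> g u \in l1.
  by move=> uN; rewrite -(perm_mem pg) map_f // mem_enum.
have oS : orients Ts (star_edges r) := orients_map g injS.
have oT : orients Tt (tree_edges r f) := orients_map h injT.
pose T := Ts ++ Tt ++ Tc ++ Ti.
have oTall : orients T (edge_set G) by rewrite EE; do 3!apply: orients_cat => //.
have pTall : perm_eq (map snd T) ls.
  rewrite lsE /T !map_cat; apply: perm_cat; first by rewrite -map_comp.
  apply: perm_cat; first by rewrite -map_comp.
  by apply: perm_cat; rewrite ?pC.
pose A := Tt ++ Tc.
have oA : orients A (tree_edges r f :|: cross_edges r f).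
  apply: orients_cat => //; apply: disjointWr dT; exact: subsetUl.
have AP x : x \in A ->
    [/\ x.1.1 \in neighbors r, x.1.2 \in far r, adj x.1.1 x.1.2 &
      x.2 \in l2 ++ l3].
  rewrite !mem_cat => /orP[/mapP[v]|xC].
    by rewrite mem_enum => vF -> /=; rewrite fN // fv // hl.
  have [? ? ?] := PC x xC; split=> //.
  by rewrite -pC map_f // orbT.
have TE v : net_sum T v = net_sum Ts v + net_sum A v + net_sum Ti v.
  by rewrite /T /A !net_sum_cat !addrA.
have Anear u : u \in neighbors r -> net_sum A u <= 0.
  move=> uN; rewrite net_sum_out; last first.
    by move=> x /AP[_ xF _ _]; rewrite eq_sym neNF.
  rewrite oppr_le0 big_seq_cond sumr_ge0 // => x /andP[/AP[_ _ _ xl] _].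
  by apply/ltW/pos; rewrite lsE mem_cat catA mem_cat xl orbT.
have Tsnear u : u \in neighbors r -> net_sum Ts u = - g u.
  move=> uN; apply: net_sum_map_tails => //.
  by apply: contraNneq rN => {1}<-.
have nearE u : u \in neighbors r ->
    net_sum T u = - (- net_sum (Tt ++ Tc ++ Ti) u + g u).
  by move=> uN; rewrite /T (net_sum_cat Ts) Tsnear // opprD opprK addrC.
have near_neg u : u \in neighbors r -> net_sum T u < 0.
  move=> uN; rewrite TE Tsnear //.
  have := Anear u uN; have := bI u; rewrite ler_norml => /andP[_ b2].
  have : M < g u by apply: ltM; rewrite mem_cat gl.
  lra.
have Sfar v : v \in far r -> net_sum Ts v = 0.
  move=> vF; apply: (net_sum_notin oS) => e /imsetP[u uN ->].
  rewrite !inE negb_or eq_sym neNF //=.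
  by apply: contraNneq rF => {1}<-.
have farE v : v \in far r -> net_sum T v = net_sum (Tc ++ Ti) v + h v.
  move=> vF; rewrite /T (net_sum_cat Ts) Sfar // add0r net_sum_cat addrC.
  congr (_ + _); apply: net_sum_map_heads => // w wF.
  by apply: neNF => //; apply: fN.
have Cfar v : v \in far r -> 0 <= net_sum Tc v.
  move=> vF; rewrite net_sum_in; last by move=> x /PC[xN _ _]; apply: neNF.
  rewrite big_seq_cond sumr_ge0 // => x /andP[xC _]; apply/ltW/pos.
  by rewrite lsE !mem_cat -pC map_f ?orbT.
have far_pos v : v \in far r -> 0 < net_sum T v.
  move=> vF; rewrite farE // net_sum_cat.
  have := Cfar v vF; have := bI v; rewrite ler_norml => /andP[b1 _].
  have : M < h v by apply: ltM; rewrite !mem_cat hl ?orbT.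
  lra.
have rE : net_sum T r = \sum_(u in neighbors r) g u.
  rewrite /T (net_sum_cat Ts) -[RHS]addr0; congr (_ + _).
    exact: net_sum_map_center.
  apply: (@net_sum_notin _ _ _ (tree_edges r f :|: (cross_edges r f :|: inner_edges r))).
    by do 2!apply: orients_cat => //.
  (* An edge through [r] is a star edge, so disjointness keeps [r] off all other classes. *)
  move=> e eT; apply: contraTN dS => re; apply/pred0Pn; exists e => /=.
  rewrite eT andbT; have eE : e \in edge_set G by rewrite EE in_setU eT orbT.
  have [x [y [xy exy]]] := edge_setP eE.
  move: re; rewrite exy in_set2 => /orP[/eqP rx|/eqP ry]; apply/imsetP.
    by exists y; rewrite ?inE rx // setUC.
  by exists x; rewrite ?inE ry // adj_sym.
have far_lt v : v \in far r -> net_sum T v < net_sum T r.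
  move=> vF.
  have v2 : h v \in l2 := hl v vF.
  have [m [l2' l2E]] : exists m l2', l2 = m :: l2'.
    by case: (l2) v2 => // m l2' _; exists m, l2'.
  have m2 : m \in l2 by rewrite l2E inE eqxx.
  (* [m] heads the decreasing block [l2], which lies above [l3], so it bounds every label on an arc
     of [A]. *)
  have lem l : l \in l2 ++ l3 -> l <= m.
    rewrite mem_cat => /orP[|l3l]; last first.
      by apply/ltW/(lt2 m) => //; rewrite mem_cat l3l.
    rewrite l2E inE => /orP[/eqP->//|ll]; apply/ltW.
    move: pw; rewrite lsE !pairwise_cat l2E /=.
    by move=> /and3P[_ _ /and3P[_ /andP[/allP h' _] _]]; apply: h'.
  have Mm : M < m by apply: ltM; rewrite !mem_cat m2 orbT.
  have m0 : 0 < m by apply: pos; rewrite lsE !mem_cat m2 orbT.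
  (* Every star label exceeds [m]; the sum is strictly larger because [neighbors r] contains
     [f v]. *)
  have S_gt : m *+ #|neighbors r| < net_sum T r.
    rewrite rE -sumr_const; apply: ltr_sum => [|u uN]; last first.
      by apply: lt1; rewrite ?gl // mem_cat m2.
    by apply/hasP; exists (f v); rewrite ?mem_index_enum ?fN.
  have A_le := @net_sum_le_count R G m A v.
  have {}A_le : net_sum A v <= m *+ count (fun x => x.1.2 == v) A.
    apply: A_le => x /AP[xN _ _ xl]; first exact: neNF.
    exact: lem.
  have c_le : (count (fun x => x.1.2 == v) A <=
      #|neighbors v :&: neighbors r|)%N.
    apply: (count_heads_le oA) => x /AP[xN _ xa _] xv.
    by rewrite in_setI xN inE adj_sym -xv xa.
  rewrite TE Sfar // add0r; apply: le_lt_trans S_gt.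
  (* If [v] is adjacent to all of [neighbors r], it is also a centre, and maximality forces equal
     neighbourhoods. Then [v] has no neighbour in [far r] and lies on no inner edge. *)
  have [sub|nsub] := boolP (neighbors r \subset neighbors v).
    have v2w : within_two v.
      apply/forallP => y; apply/or3P; have [yr|yr] := eqVneq y r.
        apply/Or33/existsP; exists (f v); rewrite adj_sym fv // yr adj_sym.
        by have := fN v vF; rewrite inE.
      have [ry|ry] := boolP (adj r y).
        by apply: Or32; have := subsetP sub y; rewrite !inE; apply.
      have yF : y \in far r by rewrite inE yr.
      apply/Or33/existsP; exists (f y); rewrite fv // andbT.
      by have := subsetP sub _ (fN y yF); rewrite inE.
    have Nv : neighbors r = neighbors v by apply/eqP; rewrite eqEcard sub rmax.
    have -> : net_sum Ti v = 0.
      apply: (net_sum_notin oI) => e; rewrite inE => /andP[eE einc].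
      apply/negP => ve.
      have {}einc : e \subset far r.
        by case/orP: einc => // /subsetP/(_ v ve); rewrite (negPf (FN v vF)).
      have [x [y [xy exy]]] := edge_setP eE.
      have [w [vw we]] : exists w, adj v w /\ w \in e.
        move: ve; rewrite exy in_set2 => /orP[/eqP->|/eqP->].
          by exists y; rewrite set22.
        by exists x; rewrite set21 adj_sym.
      have := FN w (subsetP einc w we).
      by rewrite Nv inE vw.
    rewrite addr0; apply: (le_trans A_le); apply: ler_wpMn2l; rewrite ?ltW //.
    by apply: (leq_trans c_le); rewrite subset_leq_card // subsetIr.
  (* Otherwise at most [#|neighbors r|] minus one arcs of [A] enter [v], and the spare [m] exceeds
     the inner contribution, which is at most [M]. *)
  have c_lt : (count (fun x => x.1.2 == v) A < #|neighbors r|)%N.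
    apply: (leq_ltn_trans c_le); apply: proper_card; rewrite properE subsetIr /=.
    by rewrite subsetI negb_and nsub.
  have := bI v; rewrite ler_norml => /andP[_ b2].
  apply: (@le_trans _ _ (m *+ (count (fun x => x.1.2 == v) A).+1)).
    rewrite mulrSr; apply: lerD => //; exact: (le_trans b2 (ltW Mm)).
  by apply: ler_wpMn2l; rewrite ?ltW.
have r_ge0 : 0 <= net_sum T r.
  rewrite rE sumr_ge0 // => u uN; apply/ltW/pos.
  by rewrite lsE mem_cat gl.
have classes v : [\/ v = r, v \in neighbors r | v \in far r].
  have [->|vr] := eqVneq v r; first exact: Or31.
  by have [rv|rv] := boolP (adj r v); [apply: Or32 | apply: Or33]; rewrite inE ?vr.
exists T; split=> // x y xy.
(* Sums are negative on [neighbors r], nonnegative at [r], and on [far r] positive but below the sum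
   at [r]; equal sums thus lie in one class, where [injg] or [injh] applies. *)
have [xr|xN|xF] := classes x; have [yr|yN|yF] := classes y.
- by rewrite xr yr.
- by have := near_neg y yN; rewrite -xy xr ltNge r_ge0.
- by have := far_lt y yF; rewrite -xy xr ltxx.
- by have := near_neg x xN; rewrite xy yr ltNge r_ge0.
- apply: injg; rewrite ?mem_enum //=.
  by apply: oppr_inj; rewrite -!nearE.
- by have := far_pos y yF; rewrite -xy ltNge ltW // near_neg.
- by have := far_lt x xF; rewrite xy yr ltxx.
- by have := far_pos x xF; rewrite xy ltNge ltW // near_neg.
- by apply: injh; rewrite ?mem_enum //= -!farE.
Qed.

Theorem theorem3 (R : realType) (G : sgraph)
    (G_connected : connected G) (G_radius : radius G = 2%N) :
  universal_antimagic_orientable R G.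
Proof.
move=> L sL posL.
have [x0 x02] := radius_two_center G_connected G_radius.
pose r := [arg max_(x > x0 | within_two x) #|neighbors x|]%N.
have [r2 rmax] : within_two r /\
    forall x : G, within_two x -> (#|neighbors x| <= #|neighbors r|)%N.
  by rewrite /r; case: arg_maxnP.
pose ls := rev (sort <=%R L).
have pls : perm_eq ls L by rewrite perm_rev perm_sort.
have [|||T [oT pT injT]] := antimagic_arcs (ls := ls) r2 rmax.
- by rewrite (perm_size pls).
- by rewrite rev_sorted sort_lt_sorted fset_uniq.
- by move=> l; rewrite (perm_mem pls); apply: posL.
exact: (antimagic_of_arcs oT (perm_trans pT pls) injT).
Qed.
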